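(* Assume that the following statement (Tachibana's theorem) is true: a Finsler manifold $(M,F)$ of dimension $n$ admits a concurrent vector field if and only if its line element is expressible in the form $ds^2=(dx^n)^2+(x^n)^2H(x^\alpha,dx^\alpha)$, $\alpha=1,\dots,n-1$, where $H(x^\alpha,dx^\alpha)$ is the square of the line element of an arbitrary $(n-1)$-dimensional Finsler manifold. Then a Finsler metric admitting a concurrent vector field is Riemannian. Consequently, there is no regular non-Riemannian Finsler metric admitting a concurrent vector field.
   Context: Manifolds are smooth and connected. A (regular) Finsler metric on a manifold $M$ is a function $F:TM\to\mathbb R$ with $F\ge 0$, $F(0)=0$; $F$ is $C^\infty$ on the slit tangent bundle $TM\setminus\{0\}$; $F(x,\lambda y)=\lambda F(x,y)$ for $\lambda>0$; and $g_{ij}(x,y):=\frac12\frac{\partial^2F^2}{\partial y^i\partial y^j}$ is positive definite at each point of $TM\setminus\{0\}$. The pair $(M,F)$ is then called a Finsler manifold; $(x^i)$ are coordinates on $M$ and $(y^i)$ the induced fibre coordinates on $TM$. The line element is $ds=F(x,dx)$. Notation: $\partial_i=\partial/\partial x^i$, $\dot\partial_i=\partial/\partial y^i$; $(g^{ij})$ is the inverse of $(g_{ij})$; repeated indices are summed. Cartan tensor: $C_{ijk}:=\frac12\dot\partial_kg_{ij}$. $(M,F)$ is Riemannian if $C_{ijk}=0$, equivalently $g_{ij}$ depends on $x$ only. Cartan connection (horizontal part): $G^i=\frac14 g^{ih}\big(y^r\partial_r\dot\partial_hF^2-\partial_hF^2\big)$ are the components of the geodesic spray, $N^i_j:=\dot\partial_jG^i$,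 $\delta_i:=\partial_i-N^r_i\dot\partial_r$, $\Gamma^i_{jk}:=\frac12g^{ir}(\delta_jg_{kr}+\delta_kg_{jr}-\delta_rg_{jk})$, and for a vector field $X^i(x)$ on $M$, $X^i{}_{|j}:=\delta_jX^i+X^m\Gamma^i_{mj}$. A vector field $X^i(x)$ on $M$ is concurrent (with respect to the Cartan connection) if $X^h(x)\,C_{hij}=0$ and $X^i{}_{|j}=-\delta^i_j$ (Kronecker delta). *)

(* Defs.v *)
From HB Require Import structures.
From mathcomp Require Import all_boot all_order all_algebra.
From mathcomp Require Import all_classical all_reals all_analysis.

Set Implicit Arguments.
Unset Strict Implicit.
Unset Printing Implicit Defensive.
Import Order.TTheory GRing.Theory Num.Theory.
Import numFieldNormedType.Exports.

Local Open Scope ring_scope.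
Local Open Scope classical_set_scope.

(** [Ck k U f]: [f] is of class C^k on the open set [U].  Between
    finite-dimensional spaces, [f] is C^(k+1) iff it is differentiable and every
    directional derivative [x |-> Df(x) v] is C^k. *)
Fixpoint Ck (R : realType) (V W : normedModType R) (k : nat)
    (U : set V) (f : V -> W) : Prop :=
  match k with
  | 0%N => forall x, U x -> {for x, continuous f}
  | k'.+1 => (forall x, U x -> differentiable f x) /\
             (forall v, Ck k' U (fun x => 'D_v f x))
  end.

Definition smooth (R : realType) (V W : normedModType R)
    (U : set V) (f : V -> W) : Prop := forall k, Ck k U f.

(** A homeomorphism from the open set [cdom] of [M] onto the open set [crng] of
    R^n; the values of [cmap] off [cdom] and of [cinv] off [crng] are
    irrelevant. *)
Record chart (R : realType) (n : nat) (M : topologicalType) := Chart {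
  cdom : set M;
  crng : set 'rV[R]_n;
  cmap : M -> 'rV[R]_n;
  cinv : 'rV[R]_n -> M;
  cdom_open : open cdom;
  crng_open : open crng;
  cmap_crng : forall p, cdom p -> crng (cmap p);
  cinv_cdom : forall x, crng x -> cdom (cinv x);
  cmapK : forall p, cdom p -> cinv (cmap p) = p;
  cinvK : forall x, crng x -> cmap (cinv x) = x;
  cmap_continuous : forall p, cdom p -> {for p, continuous cmap};
  cinv_continuous : forall x, crng x -> {for x, continuous cinv} }.

(** Change of coordinates from [c] to [d], and the part of [crng c] on which it
    is defined. *)
Definition transition (R : realType) (n : nat) (M : topologicalType)
    (c d : chart R n M) : 'rV[R]_n -> 'rV[R]_n := fun x => cmap d (cinv c x).

Definition overlap (R : realType) (n : nat) (M : topologicalType)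
    (c d : chart R n M) : set 'rV[R]_n :=
  [set x | crng c x /\ cdom d (cinv c x)].

Definition compatible (R : realType) (n : nat) (M : topologicalType)
    (c d : chart R n M) : Prop :=
  smooth (overlap c d) (transition c d) /\
  smooth (overlap d c) (transition d c).

(** Connected smooth manifold of dimension [n]; the smooth structure is a
    maximal atlas, so [atlas] contains every admissible coordinate system. *)
Record manifold (R : realType) (n : nat) := Manifold {
  mspace :> topologicalType;
  atlas : set (chart R n mspace);
  mspace_hausdorff : hausdorff_space mspace;
  mspace_second_countable : @second_countable mspace;
  mspace_connected : connected [set: mspace];
  atlas_cover : forall p : mspace, exists2 c, atlas c & cdom c p;
  atlas_compatible : forall c d, atlas c -> atlas d -> compatible c d;
  atlas_maximal :
    forall c, (forall d, atlas d -> compatible c d) -> atlas c }.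

(** Functions of [(x, y)], with [x] the coordinates of a point and [y] the
    induced fibre coordinates, are curried.  In terms of the classical notation:
    [dx i] is d/dx^i, [dy i] is d/dy^i, [fund i j] is g_ij, [fundV i j] is g^ij,
    [cartan i j k] is C_ijk, [spray i] is G^i, [nonlin i j] is N^i_j, [hder i] is
    delta_i, [hGamma i j k] is Gamma^i_jk and [hcov X i j] is X^i_|j. *)

Definition dx (R : realType) (n : nat) (i : 'I_n)
    (f : 'rV[R]_n -> 'rV[R]_n -> R) : 'rV[R]_n -> 'rV[R]_n -> R :=
  fun x y => 'D_(delta_mx ord0 i) (fun x' => f x' y) x.

Definition dy (R : realType) (n : nat) (i : 'I_n)
    (f : 'rV[R]_n -> 'rV[R]_n -> R) : 'rV[R]_n -> 'rV[R]_n -> R :=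
  fun x y => 'D_(delta_mx ord0 i) (fun y' => f x y') y.

Section CoordinateTensors.
Context {R : realType} {n : nat} (F : 'rV[R]_n -> 'rV[R]_n -> R).

Definition sqF : 'rV[R]_n -> 'rV[R]_n -> R := fun x y => F x y ^+ 2.

Definition fund (i j : 'I_n) : 'rV[R]_n -> 'rV[R]_n -> R :=
  fun x y => 2^-1 * dy i (dy j sqF) x y.

Definition fundV (i j : 'I_n) : 'rV[R]_n -> 'rV[R]_n -> R :=
  fun x y => invmx (\matrix_(a, b) fund a b x y) i j.

Definition cartan (i j k : 'I_n) : 'rV[R]_n -> 'rV[R]_n -> R :=
  fun x y => 2^-1 * dy k (fund i j) x y.

Definition spray (i : 'I_n) : 'rV[R]_n -> 'rV[R]_n -> R :=
  fun x y => 4^-1 * \sum_h fundV i h x y *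
    (\sum_r y ord0 r * dx r (dy h sqF) x y - dx h sqF x y).

Definition nonlin (i j : 'I_n) : 'rV[R]_n -> 'rV[R]_n -> R := dy j (spray i).

Definition hder (i : 'I_n) (f : 'rV[R]_n -> 'rV[R]_n -> R) :
    'rV[R]_n -> 'rV[R]_n -> R :=
  fun x y => dx i f x y - \sum_r nonlin r i x y * dy r f x y.

Definition hGamma (i j k : 'I_n) : 'rV[R]_n -> 'rV[R]_n -> R :=
  fun x y => 2^-1 * \sum_r fundV i r x y *
    (hder j (fund k r) x y + hder k (fund j r) x y - hder r (fund j k) x y).

Definition hcov (X : 'rV[R]_n -> 'rV[R]_n) (i j : 'I_n) :
    'rV[R]_n -> 'rV[R]_n -> R :=
  fun x y => hder j (fun x' _ => X x' ord0 i) x y +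
    \sum_m X x ord0 m * hGamma i m j x y.

End CoordinateTensors.

(** A function on TM is given by its expressions in the charts [(x, y)] of TM
    induced by the charts of M.  Under a change of coordinates [tau], the fibre
    coordinates [y] at [x] become [D tau (x) y = 'D_y tau x].  Only the values at
    [x] in [crng c], for [c] in the atlas, are meaningful. *)
Record finsler (R : realType) (n : nat) (M : manifold R n) := Finsler {
  finF :> chart R n M -> 'rV[R]_n -> 'rV[R]_n -> R;
  finF_change : forall c d, atlas c -> atlas d -> forall x y, overlap c d x ->
    finF d (transition c d x) ('D_y (transition c d) x) = finF c x y;
  finF_ge0 : forall c, atlas c -> forall x y, crng c x -> 0 <= finF c x y;
  finF_0 : forall c, atlas c -> forall x, crng c x -> finF c x 0 = 0;
  finF_smooth : forall c, atlas c ->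
    smooth [set z : 'rV[R]_n * 'rV[R]_n | crng c z.1 /\ z.2 <> 0]
           (fun z : 'rV[R]_n * 'rV[R]_n => (finF c z.1 z.2 : R^o));
  finF_homogeneous : forall c, atlas c -> forall x y (l : R), crng c x ->
    0 < l -> finF c x (l *: y) = l * finF c x y;
  finF_posdef : forall c, atlas c -> forall x y, crng c x -> y <> 0 ->
    forall v : 'rV[R]_n, v <> 0 ->
    0 < \sum_i \sum_j fund (finF c) i j x y * v ord0 i * v ord0 j }.

Definition riemannian (R : realType) (n : nat) (M : manifold R n)
    (F : finsler M) : Prop :=
  forall c, atlas c -> forall x y, crng c x -> y <> 0 ->
  forall i j k, cartan (F c) i j k x y = 0.

(** Smooth vector field on the open subset [U] of [M], given by its components
    in all charts. *)
Definition vector_field (R : realType) (n : nat) (M : manifold R n)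
    (U : set M) (X : chart R n M -> 'rV[R]_n -> 'rV[R]_n) : Prop :=
  (forall c, atlas c -> smooth [set x | crng c x /\ U (cinv c x)] (X c)) /\
  (forall c d, atlas c -> atlas d -> forall x, overlap c d x -> U (cinv c x) ->
     X d (transition c d x) = 'D_(X c x) (transition c d) x).

Definition concurrent (R : realType) (n : nat) (M : manifold R n)
    (F : finsler M) (U : set M) (X : chart R n M -> 'rV[R]_n -> 'rV[R]_n) :
    Prop :=
  vector_field U X /\
  forall c, atlas c -> forall x y, crng c x -> U (cinv c x) -> y <> 0 ->
    (forall i j, \sum_h X c x ord0 h * cartan (F c) h i j x y = 0) /\
    (forall i j, hcov (F c) (X c) i j x y = - (i == j)%:R).

Definition admits_concurrent (R : realType) (n : nat) (M : manifold R n)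
    (F : finsler M) : Prop :=
  exists X, concurrent F [set: M] X.

Definition locally_admits_concurrent (R : realType) (n : nat)
    (M : manifold R n) (F : finsler M) : Prop :=
  forall p : M, exists U : set M, [/\ open U, U p & exists X, concurrent F U X].

(** [(x^1, .., x^n) |-> (x^1, .., x^(n-1))], the total dimension being [n.+1]
    here; the last coordinate is [x ord0 ord_max]. *)
Definition init_coord (R : realType) (n : nat) (x : 'rV[R]_n.+1) : 'rV[R]_n :=
  \row_(a < n) x ord0 (widen_ord (leqnSn n) a).

(** Around every point there are coordinates in which
    ds^2 = (dx^n)^2 + (x^n)^2 H(x^a, dx^a), where H is the square of the line
    element [K] of a Finsler manifold [N] of dimension one less, expressed in a
    chart [d] of [N]. *)
Definition line_element_conical (R : realType) (n : nat)
    (M : manifold R n.+1) (F : finsler M) : Prop :=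
  forall p : M, exists c : chart R n.+1 M,
    [/\ atlas c, cdom c p &
      exists (N : manifold R n) (K : finsler N) (d : chart R n N),
        atlas d /\
        forall x, crng c x -> crng d (init_coord x) /\
          forall y, F c x y ^+ 2 =
            y ord0 ord_max ^+ 2 +
            x ord0 ord_max ^+ 2 * K d (init_coord x) (init_coord y) ^+ 2 ].

(** Both sides are local: a manifold that is everywhere locally of the above
    form (a flat torus, say) need not carry a global concurrent field, and the
    form itself only exists in coordinate neighbourhoods. *)
Definition tachibana (R : realType) (n : nat) : Prop :=
  forall (M : manifold R n.+1) (F : finsler M),
    locally_admits_concurrent F <-> line_element_conical F.

(* Main.v *)
Require Import Defs.
From mathcomp Require Import all_boot all_order all_algebra.
From mathcomp Require Import all_classical all_reals all_analysis.
From mathcomp Require Import ring lra.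

(** Tachibana's theorem gives, around every point, coordinates in which
    F^2 = (y^n)^2 + (x^n)^2 H(x^a, y^a) with H positively homogeneous of degree 2
    in y^a.  The right-hand side contains H at y^a = 0, where an arbitrary
    Finsler square H need not be twice differentiable; but the point with fibre
    coordinates y^a = 0, y^n = 1 lies in the slit tangent bundle, where F^2 is
    smooth.  So the second term P(y) = (x^n)^2 H, which does not change when y is
    translated along the n-th fibre axis, is twice differentiable on the whole
    fibre, the origin included.

    A positively 2-homogeneous function with that regularity at the origin is a
    quadratic form ([homogeneous2_quadratic]): its directional derivatives are
    1-homogeneous and differentiable at 0, hence coincide with their differential
    at 0 and are linear ([homogeneous1_derive]), and Euler's identity
    2 P(y) = D_y P(y) ([homogeneous2_euler]) recovers P from them.  Therefore F^2
    is a quadratic form on every fibre in these coordinates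
    ([conical_quadratic]).  Fibre coordinates change linearly, so F^2 is quadratic
    on the fibres in every chart ([quadratic_mulmx]), and the Cartan tensor, a
    third fibre derivative of F^2, vanishes ([quadratic_cartan]).  At points where
    x^n = 0 the same argument applies, with P = 0. *)

Set Implicit Arguments.
Unset Strict Implicit.
Unset Printing Implicit Defensive.
Import Order.TTheory GRing.Theory Num.Theory.
Import numFieldNormedType.Exports.

Local Open Scope ring_scope.
Local Open Scope classical_set_scope.

Lemma near_eq_differentiable (R : realType) (V W : normedModType R)
    (f g : V -> W) x :
  {near x, f =1 g} -> differentiable f x -> differentiable g x.
Proof.
move=> fg df.
have [Lc Lf] := (diff_locallyP x f).1 df.
have fgx : f x = g x := nbhs_singleton fg.
have Lg : g \o shift x = cst (g x) + 'd f x +o_ 0 id.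
  apply/eqaddoP => e e0.
  move/eqaddoP: Lf => /(_ e e0) Lf.
  have fgs : \forall h \near 0, f (h + x) = g (h + x).
    rewrite (near_shift x); near=> h.
    by rewrite /= sub0r subrK; near: h; exact: fg.
  near=> h.
  have -> : ((g \o shift x) - (cst (g x) + 'd f x)) h =
            ((f \o shift x) - (cst (f x) + 'd f x)) h.
    by rewrite /= !fctE /= -fgx; congr (_ - _); apply/esym; near: h; exact: fgs.
  by near: h; exact: Lf.
by apply/diff_locallyP; rewrite (diff_unique Lc Lg).
Unshelve. all: by end_near. Qed.

Definition pos_homogeneous (R : realType) (V : normedModType R) (k : nat)
    (f : V -> R) : Prop :=
  forall l z, 0 < l -> f (l *: z) = l ^+ k * f z.

(** Along a ray the difference quotient of [g] at 0 is constant, equal to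
    [g z]. *)
Lemma homogeneous1_derive (R : realType) (V : normedModType R) (g : V -> R) :
  pos_homogeneous 1 g -> differentiable g 0 -> forall z, g z = 'D_z g 0.
Proof.
move=> gZ dg z.
have g0 : g 0 = 0 by have := gZ 2 0 (ltr0Sn _ 1); rewrite scaler0; lra.
(* homogeneity only sees positive factors: compute the limit from the right *)
rewrite /derive cvg_at_rightE; last exact: diff_derivable.
apply/esym/cvg_lim => //; apply: cvg_near_cst.
near=> h; have h0 : 0 < h by near: h; exact: nbhs_right_gt.
by rewrite /= addr0 g0 subr0 gZ// [LHS]mulKf// gt_eqF.
Unshelve. all: by end_near. Qed.

(** Euler's identity: since P(z + h z) = (1 + h)^2 P(z) for small h, of either
    sign, the difference quotient of [P] at [z] along [z] is (h + 2) P(z). *)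
Lemma homogeneous2_euler (R : realType) (V : normedModType R) (P : V -> R) z :
  pos_homogeneous 2 P -> 'D_z P z = 2 * P z.
Proof.
move=> PZ; rewrite /derive; apply/cvg_lim => //.
have : (h + 2) * P z @[h --> (0 : R)^'] --> (0 + 2) * P z.
  apply: cvg_within_filter; apply: cvgM; last exact: cvg_cst.
  by apply: cvgD; [exact: cvg_id|exact: cvg_cst].
rewrite add0r; apply: cvg_trans; apply: near_eq_cvg; near=> h.
have h0 : h != 0 by near: h; exact: nbhs_dnbhs_neq.
have h1 : 0 < h + 1.
  have : `|h| < 1 by near: h; apply: dnbhs0_lt.
  by rewrite ltr_norml => /andP[]; lra.
by rewrite /= -[X in h *: z + X]scale1r -scalerDl PZ// /GRing.scale/=; field.
Unshelve. all: by end_near. Qed.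

Lemma homogeneous2_derive (R : realType) (V : normedModType R) (P : V -> R) v :
  pos_homogeneous 2 P -> (forall y, differentiable P y) ->
  pos_homogeneous 1 ('D_v P).
Proof.
move=> PZ dP l z l0; rewrite expr1; apply: (mulfI (lt0r_neq0 l0)).
(* rescaling the increment along with the base point makes the difference
   quotients proportional *)
have -> : l * 'D_v P (l *: z) = 'D_(l *: v) P (l *: z).
  by rewrite !deriveE// linearZ.
have dv : derivable P z v by exact: diff_derivable.
rewrite mulrA -expr2 [LHS]/derive; apply: cvg_lim => //.
have : l ^+ 2 * (h^-1 *: (P (h *: v + z) - P z)) @[h --> (0 : R)^'] -->
       l ^+ 2 * 'D_v P z.
  by apply: cvgM; [exact: cvg_cst|exact: dv].
apply: cvg_trans; apply: near_eq_cvg; apply: nearW => h /=.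
by rewrite scalerA [h * l]mulrC -scalerA -scalerDr !PZ// -mulrBr -!scalerAr.
Qed.

Lemma derive_row (R : realType) m (g : 'rV[R]_m -> R) z v :
  differentiable g z -> 'D_v g z = \sum_i v 0 i * 'D_('e_i) g z.
Proof.
move=> dg; rewrite deriveE// {1}[v]row_sum_delta linear_sum.
by apply: eq_bigr => i _; rewrite linearZ deriveE.
Qed.

Definition quadratic (R : realType) m (f : 'rV[R]_m -> R) : Prop :=
  exists A : 'M[R]_m, forall y, f y = (y *m A *m y^T) 0 0.

(** Each partial derivative of [P] is linear, being 1-homogeneous and
    differentiable at 0; substituted in Euler's identity, this gives the quadratic
    form whose matrix is half the Hessian of [P] at 0. *)
Lemma homogeneous2_quadratic (R : realType) m (P : 'rV[R]_m -> R) :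
  pos_homogeneous 2 P -> (forall y, differentiable P y) ->
  (forall v, differentiable ('D_v P) 0) -> quadratic P.
Proof.
move=> PZ dP dDP.
exists (\matrix_(i, j) (2^-1 * 'D_('e_i) ('D_('e_j) P) 0)) => y.
have e : 2 * P y = \sum_j \sum_i y 0 i * 'D_('e_i) ('D_('e_j) P) 0 * y 0 j.
  rewrite -(homogeneous2_euler y PZ) (derive_row y (dP y)).
  apply: eq_bigr => j _.
  have -> : 'D_('e_j) P y = 'D_y ('D_('e_j) P) 0.
    exact: homogeneous1_derive (homogeneous2_derive _ PZ dP) (dDP _) y.
  by rewrite (derive_row y (dDP _)) mulrC mulr_suml.
have n2 : 2 != 0 :> R by rewrite pnatr_eq0.
apply: (mulfI n2).
rewrite e mxE mulr_sumr; apply: eq_bigr => j _.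
rewrite !mxE mulr_suml mulr_sumr; apply: eq_bigr => i _.
by rewrite mxE; field.
Qed.

Lemma quadratic_mulmx (R : realType) m k (B : 'M[R]_(k, m))
    (f : 'rV[R]_m -> R) :
  quadratic f -> quadratic (fun y => f (y *m B)).
Proof.
by move=> [A fE]; exists (B *m A *m B^T) => y; rewrite fE trmx_mul !mulmxA.
Qed.

(** Reads a derivative off an exact expansion of order two; it applies to linear
    ([b = 0]) and to quadratic functions. *)
Lemma derive_expansion2 (R : realType) (V : normedModType R) (f : V -> R)
    v y a b :
  (forall h : R, f (h *: v + y) - f y = h * a + h ^+ 2 * b) -> 'D_v f y = a.
Proof.
move=> fE; rewrite /derive; apply: cvg_lim => //.
have : a + h * b @[h --> (0 : R)^'] --> a + 0 * b.
  apply: cvg_within_filter; apply: cvgD; first exact: cvg_cst.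
  by apply: cvgM; [exact: cvg_id|exact: cvg_cst].
rewrite mul0r addr0; apply: cvg_trans; apply: near_eq_cvg; near=> h.
have h0 : h != 0 by near: h; exact: nbhs_dnbhs_neq.
by rewrite /= fE /GRing.scale/=; field.
Unshelve. all: by end_near. Qed.

Lemma quadratic_derive (R : realType) m (A : 'M[R]_m) v y :
  'D_v (fun y : 'rV[R]_m => (y *m A *m y^T) 0 0) y =
  (v *m A *m y^T + y *m A *m v^T) 0 0.
Proof.
apply: (@derive_expansion2 _ _ _ _ _ _ ((v *m A *m v^T) 0 0)) => h.
rewrite linearD linearZ/= !mulmxDl !mulmxDr -!scalemxAl -!scalemxAr !mxE.
by ring.
Qed.

Lemma quadratic_derive2 (R : realType) m (f : 'rV[R]_m -> R) v w :
  quadratic f -> exists c, 'D_v ('D_w f) = cst c.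
Proof.
move=> [A fE]; exists ((w *m A *m v^T + v *m A *m w^T) 0 0).
have -> : f = fun y => (y *m A *m y^T) 0 0 by exact/funext.
have -> : 'D_w (fun y : 'rV_m => (y *m A *m y^T) 0 0) =
          fun y => (w *m A *m y^T + y *m A *m w^T) 0 0.
  by apply/funext => y; exact: quadratic_derive.
apply/funext => y /=; apply: (@derive_expansion2 _ _ _ _ _ _ 0) => h.
rewrite linearD linearZ/= !mulmxDl !mulmxDr -!scalemxAl -!scalemxAr !mxE.
by ring.
Qed.

Lemma quadratic_cartan (R : realType) m (F : 'rV[R]_m -> 'rV[R]_m -> R) x y
    i j k :
  quadratic (fun y => F x y ^+ 2) -> cartan F i j k x y = 0.
Proof.
move=> /(quadratic_derive2 (delta_mx 0 i) (delta_mx 0 j))[c cE].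
rewrite /cartan /fund /dy.
have -> : (fun y' => 2^-1 * 'D_(delta_mx 0 i)
             (fun y0 => 'D_(delta_mx 0 j) [eta sqF F x] y0) y') =
          cst (2^-1 * c).
  by apply/funext => y' /=; congr (_ * _); exact: (congr1 (fun g => g y') cE).
by rewrite derive_cst mulr0.
Qed.

(** The regularity of a Finsler metric on one fibre that the proof uses, up to
    order two and away from the zero vector. *)
Definition slit_differentiable2 (R : realType) n (f : 'rV[R]_n -> R) : Prop :=
  (forall y, y != 0 -> differentiable f y) /\
  (forall v y, y != 0 -> differentiable ('D_v f) y).

(** [P = f - (y^n)^2] is invariant under translation by [e], the n-th basis
    vector, so its regularity at [e] is also its regularity at the origin, and
    2-homogeneity makes it quadratic. *)
Lemma conical_quadratic (R : realType) n (f : 'rV[R]_n.+1 -> R)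
    (q : 'rV[R]_n -> R) :
  slit_differentiable2 f -> pos_homogeneous 2 q ->
  (forall y, f y = y 0 ord_max ^+ 2 + q (init_coord y)) -> quadratic f.
Proof.
move=> [df ddf] qZ fE.
pose e : 'rV[R]_n.+1 := delta_mx 0 ord_max.
have e0 : e != 0.
  by apply/eqP => /rowP/(_ ord_max); rewrite !mxE !eqxx; exact/eqP/oner_neq0.
pose s : 'rV[R]_n.+1 -> R := fun y => y 0 ord_max ^+ 2.
pose P := f - s.
have PE y : P y = q (init_coord y) by rewrite /P !fctE fE /s; ring.
have Pe y : P (y + e) = P y.
  rewrite !PE; congr q; apply/rowP => a; rewrite !mxE.
  by rewrite -[_ == ord_max]val_eqE /= ltn_eqF ?ltn_ord// addr0.
have DPe v y : 'D_v P (y + e) = 'D_v P y.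
  rewrite /derive; apply: (congr1 (fun u : R -> R => lim (u @ 0^'))).
  by apply/funext => h; rewrite /= addrA !Pe.
have d_translate (g : 'rV[R]_n.+1 -> R) :
    (forall y, g (y + e) = g y) -> differentiable g e -> differentiable g 0.
  move=> ge dg; have -> : g = g \o (fun y => y + e) by apply/funext => y /=.
  by apply: differentiable_comp => //=; rewrite add0r.
have ds y : differentiable s y.
  exact: (@differentiableX _ _ (fun y : 'rV[R]_n.+1 => y 0 ord_max) 1 y
            (differentiable_coord y 0 ord_max)).
have dP y : differentiable P y.
  have [->|y0] := eqVneq y 0; last by apply: differentiableB => //; exact: df.
  by apply: d_translate => //; apply: differentiableB => //; exact: df.
have df' y : differentiable f y.
  have -> : f = P + s by rewrite /P subrK.
  exact: differentiableD.
have Ds v : 'D_v s = fun y => (2 * v 0 ord_max) *: y 0 ord_max.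
  apply/funext => y.
  apply: (@derive_expansion2 _ _ _ _ _ _ (v 0 ord_max ^+ 2)) => h.
  by rewrite /s /GRing.scale /= !mxE; ring.
have dDP v : differentiable ('D_v P) 0.
  apply: d_translate => //.
  have -> : 'D_v P = 'D_v f - 'D_v s.
    by apply/funext => y; rewrite deriveB//; exact: diff_derivable.
  apply: differentiableB; first exact: ddf.
  by rewrite Ds; apply: differentiableZ; exact: differentiable_coord.
have [A PA] : quadratic P.
  apply: homogeneous2_quadratic => // l z l0; rewrite !PE -qZ//; congr q.
  by apply/rowP => a; rewrite !mxE.
exists (A + delta_mx ord_max ord_max) => y.
rewrite mulmxDr mulmxDl mxE -PA PE fE addrC; congr (_ + _).
rewrite mxE (bigD1 ord_max)//= big1 => [|i i0]; rewrite !mxE.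
  rewrite (bigD1 ord_max)//= big1 => [|j j0]; rewrite !mxE ?eqxx.
    by rewrite !addr0 mulr1 expr2.
  by rewrite (negbTE j0) mulr0.
by rewrite big1 ?mul0r// => j _; rewrite !mxE (negbTE i0) andbF mulr0.
Qed.

Lemma smooth_slit_differentiable2 (R : realType) n (U : set 'rV[R]_n)
    (G : 'rV[R]_n -> 'rV[R]_n -> R) x :
  smooth [set z : 'rV[R]_n * 'rV[R]_n | U z.1 /\ z.2 <> 0]
    (fun z : 'rV[R]_n * 'rV[R]_n => (G z.1 z.2 : R^o)) ->
  U x -> slit_differentiable2 (G x).
Proof.
pose H := fun z : 'rV[R]_n * 'rV[R]_n => (G z.1 z.2 : R^o).
move=> sG Ux; have [dG ddG] := sG 2.
have fiber (g : 'rV[R]_n * 'rV[R]_n -> R) y :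
    differentiable g (x, y) -> differentiable (fun y => g (x, y)) y.
  by move=> dg; exact: (@differentiable_comp _ _ _ _ (fun y => (x, y))).
split=> [y /eqP y0|v y /eqP y0].
  by apply: (fiber H); exact: dG.
(* a derivative along the fibre is one of the total space in a vertical
   direction *)
have -> : 'D_v (G x) = fun y => 'D_(0, v) H (x, y).
  apply/funext => y'; rewrite /derive.
  apply: (congr1 (fun u : R -> R => lim (u @ 0^'))).
  by apply/funext => h /=; rewrite /H /= scaler0 add0r.
by have [dDG _] := ddG (0, v); apply: (fiber ('D_(0, v) H)); exact: dDG.
Qed.

Lemma slit_differentiable2_sqr (R : realType) n (g : 'rV[R]_n -> R) :
  slit_differentiable2 g -> slit_differentiable2 (g ^+ 2).
Proof.
move=> [dg ddg]; split=> [y y0|v y y0].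
  by apply: differentiableX; exact: dg.
(* the rule D_v (g^2) = 2 g D_v g is only known off 0, hence the passage
   through germs at y *)
apply: (@near_eq_differentiable _ _ _ (2%:R *: (g * 'D_v g))); last first.
  by apply: differentiableZ; apply: differentiableM; [exact: dg|exact: ddg].
near=> z; have z0 : z != 0.
  by near: z; exact: (cvgr_neq0 (F := nbhs y) (f := id) y).
rewrite deriveX; last exact/diff_derivable/dg.
by rewrite -[LHS]/(2%:R * (g z * 'D_v g z)) mulrA.
Unshelve. all: by end_near. Qed.

Lemma conical_riemannian (R : realType) n (M : manifold R n.+1)
    (F : finsler M) :
  line_element_conical F -> riemannian F.
Proof.
move=> conF c' ac' x' y cx' _ i j k.
have [c [ac cp [N [K [d [ad FE]]]]]] := conF (cinv c' x').
have ov : overlap c' c x' by split.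
pose x := transition c' c x'.
have cx : crng c x by exact: cmap_crng.
have [Kx FKx] := FE x cx.
apply: quadratic_cartan.
have dtau : differentiable (transition c' c) x'.
  by have [/(_ 1%N)[+ _] _] := atlas_compatible ac' ac; apply.
have -> : (fun y => F c' x' y ^+ 2) =
    fun y => (F c x ^+ 2) (y *m lin1_mx ('d (transition c' c) x')).
  apply/funext => z; rewrite mul_rV_lin1 -deriveE//.
  by rewrite -(finF_change F ac' ac z ov).
apply: quadratic_mulmx.
have dF2 : slit_differentiable2 (F c x ^+ 2).
  exact/slit_differentiable2_sqr/(smooth_slit_differentiable2 (finF_smooth F ac)).
pose q z := x 0 ord_max ^+ 2 * K d (init_coord x) z ^+ 2.
apply: (@conical_quadratic _ _ _ q) => // l z l0.
by rewrite /q finF_homogeneous//; ring.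
Qed.

Theorem theorem4p3 (R : realType) (n : nat) :
  tachibana R n ->
  (forall (M : manifold R n.+1) (F : finsler M),
     admits_concurrent F -> riemannian F) /\
  ~ (exists (M : manifold R n.+1) (F : finsler M),
       ~ riemannian F /\ admits_concurrent F).
Proof.
move=> tach.
have main (M : manifold R n.+1) (F : finsler M) :
    admits_concurrent F -> riemannian F.
  move=> [X FX]; apply: conical_riemannian; apply/tach => p.
  by exists [set: M]; split; [exact: openT|by []|exists X].
by split=> // -[M [F [nR FX]]]; exact/nR/main.
Qed.
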